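(* Fix $\delta\in(0,1)$, an integer $d\ge3$, and let $D_d\in\{-1,0,1\}^{m\times n}$ denote the incidence matrix of the $d$-dimensional regular grid on $n=N^d$ vertices. Let $\theta^*\in\mathbb{R}^n$ and $y=\theta^*+\varepsilon$ with $\varepsilon\sim\mathcal N(0,\sigma^2I_n)$. Then there exist constants $C,c>0$ (depending only on $d$) such that the TV denoiser $$\hat\theta\in\operatorname*{argmin}_{\theta\in\mathbb{R}^n}\ \frac1n\|\theta-y\|_2^2+\lambda\|D_d\theta\|_1\qquad\text{with}\qquad \lambda=c\,\sigma\sqrt{\log(en/\delta)}/n$$ satisfies $$\frac1n\|\hat\theta-\theta^*\|_2^2\le\inf_{\bar\theta\in\mathbb{R}^n,\ T\subseteq[m]}\Big\{\frac1n\|\bar\theta-\theta^*\|_2^2+4\lambda\|(D_d\bar\theta)_{T^c}\|_1+\frac{C\sigma^2}{n}\big(|T|\log(en/\delta)+\log(e/\delta)\big)\Big\}$$ with probability at least $1-2\delta$. In particular, it yields $$\mathrm{MSE}(\hat\theta)\lesssim\frac{\sigma\|D_d\theta^*\|_1\wedge\sigma^2\|D_d\theta^*\|_0}{n}\log(en/\delta),$$ where $\|D_d\theta^*\|_0$ denotes the number of nonzero components of $D_d\theta^*$.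
   Context: $\mathrm{MSE}(\hat\theta)=\frac1n\|\hat\theta-\theta^*\|_2^2$. The $d$-dimensional regular grid has vertex set $[N]^d$ (identified with $[n]$, $n=N^d$, where $[k]=\{1,\dots,k\}$), and two vertices are joined by an edge iff their difference is $\pm$ a standard basis vector; $m$ is its number of edges. The incidence matrix $D_d$ has one row per edge, with one entry $1$ and one entry $-1$ at the two endpoints of the edge, and zeros elsewhere. For $x\in\mathbb{R}^m$ and $T\subseteq[m]$, $x_T$ has coordinates $x_j$ for $j\in T$ and $0$ otherwise; $T^c=[m]\setminus T$. $a\wedge b=\min(a,b)$. The notation $\lesssim$ means that the left-hand side is bounded by the right-hand side up to a constant (here depending only on $d$).
   Formalization: The final MSE bound fails if D_dθ*=0 (right side 0, MSE>0 a.s.); it is proved with an added term σ²log(e/δ)/n for every θ*, and as displayed when σ log(e/δ) ≤ ‖D_dθ*‖₁ log(en/δ). Also σ>0 is assumed. *)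

(* Defs.v *)
From HB Require Import structures.
From mathcomp Require Export all_boot all_order all_algebra.
From mathcomp Require Export all_classical all_reals all_analysis.

Set Implicit Arguments.
Unset Strict Implicit.
Unset Printing Implicit Defensive.

Import Order.TTheory GRing.Theory Num.Theory.
Import numFieldNormedType.Exports.

Local Open Scope classical_set_scope.
Local Open Scope ring_scope.

(* The vertex set [N]^d, with coordinates in {0, ..., N-1} instead of
   {1, ..., N}. *)
Definition grid_vertex (d N : nat) : finType := {ffun 'I_d -> 'I_N}.

(* x - y is a standard basis vector of Z^d. *)
Definition differ_by_basis (d N : nat) (x y : grid_vertex d N) : bool :=
  [exists i : 'I_d, [forall j : 'I_d,
     (x j)%:Z - (y j)%:Z == (j == i)%:R :> int]].

Definition grid_adj (d N : nat) (x y : grid_vertex d N) : bool :=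
  differ_by_basis x y || differ_by_basis y x.

(* Edges are unordered pairs {x, y}. *)
Definition grid_edges (d N : nat) : {set {set grid_vertex d N}} :=
  [set [set p.1; p.2]%SET | p in [pred p : grid_vertex d N * grid_vertex d N |
                                  grid_adj p.1 p.2]]%SET.

(* D is an incidence matrix of the grid: v identifies [n], n = N^d, with the
   vertices, e identifies [m] with the edges, and row j has one entry 1 and one
   entry -1, at the two endpoints of the edge e j, and zeros elsewhere.  The
   numberings and the sign of each row are arbitrary.  In particular m is
   forced to be the number of edges. *)
Definition grid_incidence (R : realType) (d N m : nat)
    (D : 'M[R]_(m, (N ^ d)%N)) : Prop :=
  exists (v : 'I_(N ^ d)%N -> grid_vertex d N)
         (e : 'I_m -> {set grid_vertex d N}),
    [/\ bijective v,
        injective e,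
        codom e =i grid_edges d N
      & forall j : 'I_m, exists a b : 'I_(N ^ d)%N,
          [/\ a != b,
              e j = [set v a; v b]%SET,
              D j a = 1,
              D j b = -1
            & forall k, k != a -> k != b -> D j k = 0]].

Definition norm2_sq (R : realType) (n : nat) (x : 'cV[R]_n) : R :=
  \sum_(i < n) x i 0 ^+ 2.

Definition norm1 (R : realType) (n : nat) (x : 'cV[R]_n) : R :=
  \sum_(i < n) `|x i 0|.

Definition norm0 (R : realType) (n : nat) (x : 'cV[R]_n) : nat :=
  #|[pred i : 'I_n | x i 0 != 0]|.

Definition coord_restrict (R : realType) (n : nat) (T : {set 'I_n})
    (x : 'cV[R]_n) : 'cV[R]_n :=
  \col_i (if i \in T then x i 0 else 0).

Definition mse (R : realType) (n : nat) (thetahat thetastar : 'cV[R]_n) : R :=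
  n%:R^-1 * norm2_sq (thetahat - thetastar).

Definition tv_objective (R : realType) (m n : nat) (D : 'M[R]_(m, n))
    (lambda : R) (y theta : 'cV[R]_n) : R :=
  n%:R^-1 * norm2_sq (theta - y) + lambda * norm1 (D *m theta).

Definition is_argmin (R : realType) (A : Type) (f : A -> R) (a : A) : Prop :=
  forall b, f a <= f b.

(* log(e n / delta) *)
Definition log_en (R : realType) (n : nat) (delta : R) : R :=
  ln (expR 1 * n%:R / delta).

(* log(e / delta) *)
Definition log_e (R : realType) (delta : R) : R := ln (expR 1 / delta).

Definition oracle_bound (R : realType) (m n : nat) (D : 'M[R]_(m, n))
    (C sigma delta lambda : R) (thetastar thetabar : 'cV[R]_n)
    (T : {set 'I_m}) : R :=
  n%:R^-1 * norm2_sq (thetabar - thetastar)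
  + 4 * lambda * norm1 (coord_restrict (~: T)%SET (D *m thetabar))
  + C * sigma ^+ 2 / n%:R * (#|T|%:R * log_en n delta + log_e delta).

(* (sigma ||D theta||_1) /\ (sigma^2 ||D theta||_0) *)
Definition sparsity_min (R : realType) (m n : nat) (D : 'M[R]_(m, n))
    (sigma : R) (theta : 'cV[R]_n) : R :=
  Num.min (sigma * norm1 (D *m theta)) (sigma ^+ 2 * (norm0 (D *m theta))%:R).

(* The random vector (eps i)_i has law N(0, sigma^2 I_n), for sigma > 0 (the
   parameter of normal_prob is the standard deviation): every coordinate is
   N(0, sigma^2) and the coordinates are mutually independent.  The product
   rule for subfamilies is obtained by taking A i = setT. *)
Definition gaussian_noise (R : realType) (disp : measure_display)
    (Omega : measurableType disp) (P : probability Omega R) (n : nat)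
    (eps : 'I_n -> {RV P >-> R}) (sigma : R) : Prop :=
  (forall (i : 'I_n) (A : set R), measurable A ->
     distribution P (eps i) A = normal_prob 0 sigma A) /\
  (forall A : 'I_n -> set R, (forall i, measurable (A i)) ->
     P (\bigcap_(i in [set: 'I_n]) (eps i @^-1` A i)) =
     (\prod_(i < n) P (eps i @^-1` A i))%E).

(* E holds with probability at least p.  E is not assumed to be measurable;
   when it is, this is equivalent to p <= P E. *)
Definition holds_with_prob (R : realType) (disp : measure_display)
    (Omega : measurableType disp) (P : probability Omega R) (p : R)
    (E : Omega -> Prop) : Prop :=
  exists A : set Omega,
    [/\ measurable A, (p%:E <= P A)%E & forall w, A w -> E w].

(* Main.v *)
Require Import Defs.
From mathcomp Require Import measurable_realfun zify ring lra.

(** The proof has a deterministic half, a geometric half and a probabilistic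
    half.

    Deterministic half.  The least-squares part of the objective is strongly
    convex, so for every competitor the minimiser beats it by an extra
    quadratic term (tv_argmin_strong).  What remains is to control the inner
    product of the noise with delta := thetahat - thetabar.  Suppose that a
    matrix S satisfies S (D theta) = theta - mean(theta).  Then that inner
    product splits into the noise average times the sum of delta, absorbed by
    the quadratic term, and the inner product of S^T eps with D delta.  If L
    exceeds twice every entry of S^T eps, where L = n lambda, the latter is at
    most L ||D delta||_1 / 2; outside T the triangle inequality trades it for
    ||(D thetabar)_{T^c}||_1, and inside T it costs at most L^2 |T| up to a
    multiple of ||D delta||_2^2, itself at most 4 d ||delta||_2^2
    (tv_oracle).

    Geometric half.  The entries of S^T eps have variance sigma^2 times the
    squared norms of the columns of S, so S must have bounded columns: this is
    where d >= 3 enters.  The pseudo-inverse of D would do, but any S is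
    allowed, and an explicit multiscale transport avoids spectral theory.  Row
    x of S is a flow that carries a unit mass from x to the uniform
    distribution on the grid: the mass is spread successively over boxes around
    x of side L_j = min(4^j, N), one coordinate at a time.  At scale j the flow
    through a given edge is at most L_j^(1-d), and only the O(L_j^d) points x
    within distance O(L_j) of the edge contribute, so scale j contributes
    O(L_j^(2-d)) to the squared norm of a column.  For d >= 3 this decays
    geometrically in j and the sum over scales is bounded
    (grid_right_inverse).

    Probabilistic half.  Independence gives the moment generating function of
    a linear form in the noise, Chernoff's inequality its tail, and a union
    bound over the at most d n edges and the noise average gives an event of
    probability at least 1 - 2 delta on which the deterministic bound applies
    (noise_event).  The sparsity bounds follow from the oracle inequality at
    thetabar = thetastar with T empty and with T the support of D thetastar
    (oracle_consequences). *)

Set Implicit Arguments.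
Unset Strict Implicit.
Unset Printing Implicit Defensive.
Import Order.TTheory GRing.Theory Num.Theory.
Import numFieldNormedType.Exports.
Local Open Scope classical_set_scope.
Local Open Scope ring_scope.

(** * Averaging over windows of an interval *)

Section window.
Variable R : realFieldType.
Implicit Types (N L x z t : nat).

(** Distribution function of the uniform law on a window of L consecutive
    integers of [0, N) that contains x; the window starts at x unless it would
    stick out on the right.  The masses are differences of this closed form,
    which makes the flows between windows explicit. *)
Definition window_cdf N L x t : R := (minn L (t - minn x (N - L)))%:R / L%:R.

Definition window_mass N L x z : R := window_cdf N L x z.+1 - window_cdf N L x z.

Definition in_reach L x z : bool := (x < z + L)%N && (z < x + L)%N.

Lemma window_cdf0 N L x : window_cdf N L x 0 = 0.
Proof. by rewrite /window_cdf sub0n minn0 mul0r. Qed.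

Lemma window_cdf_ge0 N L x t : 0 <= window_cdf N L x t.
Proof. by rewrite /window_cdf divr_ge0. Qed.

Lemma window_cdf_le1 N L x t : (0 < L)%N -> window_cdf N L x t <= 1.
Proof.
move=> L0; rewrite /window_cdf ler_pdivrMr ?ltr0n// mul1r ler_nat.
exact: geq_minl.
Qed.

Lemma window_cdf_left N L x t : (0 < L <= N)%N -> (x < N)%N ->
  (t + L <= x.+1)%N -> window_cdf N L x t = 0.
Proof.
move=> LN xN tx; rewrite /window_cdf.
have -> : minn L (t - minn x (N - L)) = 0%N by lia.
by rewrite mul0r.
Qed.

Lemma window_cdf_right N L x t : (0 < L)%N ->
  (x + L <= t)%N -> window_cdf N L x t = 1.
Proof.
move=> LN tx; rewrite /window_cdf.
have -> : minn L (t - minn x (N - L)) = L by lia.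
by rewrite divff// pnatr_eq0; lia.
Qed.

Lemma window_cdf_full N L x : (0 < L <= N)%N -> window_cdf N L x N = 1.
Proof.
move=> LN; rewrite /window_cdf.
have -> : minn L (N - minn x (N - L)) = L by lia.
by rewrite divff// pnatr_eq0; lia.
Qed.

Lemma window_mass_ge0 N L x z : 0 <= window_mass N L x z.
Proof.
rewrite /window_mass /window_cdf -mulrBl mulr_ge0 ?invr_ge0// subr_ge0 ler_nat.
lia.
Qed.

Lemma window_mass_le N L x z : window_mass N L x z <= L%:R^-1.
Proof.
rewrite /window_mass /window_cdf -mulrBl ler_piMl ?invr_ge0//.
rewrite lerBlDr nat1r ler_nat; lia.
Qed.

Lemma window_mass_in_reach N L x z : (0 < L <= N)%N -> (x < N)%N ->
  ~~ in_reach L x z -> window_mass N L x z = 0.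
Proof.
move=> LN xN; rewrite /in_reach negb_and -!leqNgt /window_mass => /orP[H|H].
  by rewrite !window_cdf_left ?subr0//; lia.
by rewrite !window_cdf_right ?subrr//; lia.
Qed.

Lemma window_mass1 N x z : (x < N)%N -> window_mass N 1 x z = (x == z)%:R.
Proof.
move=> xN; rewrite /window_mass /window_cdf divr1 divr1.
have -> : minn x (N - 1) = x by lia.
have [->|nxz] := eqVneq x z.
  have -> : minn 1 (z.+1 - z) = 1%N by lia.
  have -> : minn 1 (z - z) = 0%N by lia.
  by rewrite subr0.
apply/eqP; rewrite subr_eq add0r; apply/eqP; congr (_%:R); lia.
Qed.

Lemma window_massN N x z : (x < N)%N -> (z < N)%N ->
  window_mass N N x z = N%:R^-1.
Proof.
move=> xN zN; rewrite /window_mass /window_cdf -mulrBl subnn minn0 !subn0.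
have -> : minn N z.+1 = z.+1 by lia.
have -> : minn N z = z by lia.
by rewrite -natr1 addrAC subrr add0r mul1r.
Qed.

(** Two windows around x have distribution functions that agree (both 0 or
    both 1) away from x: moving mass from one to the other only uses edges
    within reach. *)
Lemma window_cdf_diff N L L' x z : (0 < L)%N -> (L <= L')%N -> (L' <= N)%N ->
  (x < N)%N ->
  `|window_cdf N L' x z.+1 - window_cdf N L x z.+1| <= (in_reach L' x z)%:R.
Proof.
move=> L0 LL LN xN; have [nr|] := boolP (in_reach L' x z); last first.
  rewrite /in_reach negb_and -!leqNgt => /orP[H|H].
    by rewrite !window_cdf_left ?subr0 ?normr0//; lia.
  by rewrite !window_cdf_right ?subrr ?normr0//; lia.
have L'0 : (0 < L')%N by lia.
have := window_cdf_le1 N x z.+1 L0; have := window_cdf_le1 N x z.+1 L'0.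
have := window_cdf_ge0 N L x z.+1; have := window_cdf_ge0 N L' x z.+1.
move=> h1 h2 h3 h4; rewrite ler_norml /=; apply/andP; split; lra.
Qed.

Lemma card_in_reach N L z : (#|[pred x : 'I_N | in_reach L x z]| <= L.*2)%N.
Proof.
rewrite -sum1_card big_mkcond/=.
rewrite (_ : \sum_(i < N) _ = \sum_(0 <= i < N) in_reach L i z)%N; last first.
  by rewrite big_mkord; apply: eq_bigr => i _; rewrite inE; case: in_reach.
apply: (@leq_trans (\sum_(0 <= i < z - L + N + L.*2) in_reach L i z)%N).
  rewrite [in leqRHS](@big_cat_nat _ _ _ N)//=; last by lia.
  exact: leq_addr.
rewrite (@big_cat_nat _ _ _ (z - L))//=; last by lia.
rewrite big_nat big1 ?add0n; last first.
  by move=> i /andP[_ H]; rewrite /in_reach; case: andP => // -[h1 h2]; exfalso; lia.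
rewrite (@big_cat_nat _ _ _ (z - L + L.*2))//=; [|lia|lia].
rewrite [X in (_ + X)%N]big_nat [X in (_ + X)%N]big1 ?addn0; last first.
  by move=> i /andP[H _]; rewrite /in_reach; case: andP => // -[h1 h2]; exfalso; lia.
apply: (@leq_trans (\sum_(z - L <= i < z - L + L.*2) 1)%N).
  by apply: leq_sum => i _; case: in_reach.
by rewrite sum_nat_const_nat muln1; lia.
Qed.

End window.

(** * Differences of functions on the grid *)

Section grid_shift.
Variables (d N : nat).
Local Notation V := (grid_vertex d N).
Implicit Types (k : 'I_d) (z : V).

(** At the upper face of the grid, where z + e_k does not exist, this is z
    itself. *)
Definition grid_up k z : V :=
  [ffun i => if i == k then insubd (z i) (z i).+1 else z i].

Definition grid_down k z : V :=
  [ffun i => if i == k then insubd (z i) (z i).-1 else z i].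

(** An edge is encoded by its direction and its lower endpoint. *)
Definition grid_edge (p : 'I_d * V) : bool := ((p.2 p.1).+1 < N)%N.

Lemma grid_upE k z i : ((z k).+1 < N)%N ->
  grid_up k z i = (z i + (i == k))%N :> nat.
Proof.
move=> zN; rewrite ffunE; have [->|_] := eqVneq i k; last by rewrite addn0.
by rewrite val_insubd zN addn1.
Qed.

Lemma grid_up_neq k z i : i != k -> grid_up k z i = z i.
Proof. by move=> /negbTE ik; rewrite ffunE ik. Qed.

Lemma grid_upK k z : (0 < grid_up k z k)%N && (grid_down k (grid_up k z) == z)
  = ((z k).+1 < N)%N.
Proof.
have zN := ltn_ord (z k).
apply/idP/idP => [|h].
  apply: contraTT => nz; have upk : grid_up k z k = z k.
    by apply/val_inj; rewrite ffunE eqxx val_insubd (negbTE nz).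
  apply/negP => /andP[+ /eqP/ffunP/(_ k)/(congr1 val)].
  have -> w : grid_down k w k = insubd (w k) (w k).-1 by rewrite ffunE eqxx.
  rewrite upk val_insubd (leq_ltn_trans (leq_pred _) zN) /=.
  by move=> h0 h1; lia.
rewrite (grid_upE _ h) eqxx addn1 /=; apply/eqP/ffunP => i; apply/val_inj.
rewrite ffunE; have [->|ik] := eqVneq i k; last by rewrite grid_up_neq.
by rewrite val_insubd /= (grid_upE _ h) eqxx addn1 zN.
Qed.

Lemma grid_downK k z : (0 < z k)%N -> grid_up k (grid_down k z) = z.
Proof.
move=> z0; have zN := ltn_ord (z k); apply/ffunP => i; apply/val_inj.
have dE : grid_down k z k = (z k).-1 :> nat.
  by rewrite /grid_down ffunE eqxx val_insubd; case: ifP => //; lia.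
have [->|ik] := eqVneq i k; last by rewrite grid_up_neq// ffunE (negbTE ik).
by rewrite /= grid_upE dE ?eqxx ?addn1 prednK.
Qed.

(** The shift by e_k is a bijection from the lower endpoints of the edges of
    direction k onto the vertices whose k-th coordinate is nonzero. *)
Lemma reindex_grid_up (R : nmodType) k (F : V -> R) :
  \sum_(z : V | (0 < z k)%N) F z = \sum_(z : V | ((z k).+1 < N)%N) F (grid_up k z).
Proof.
rewrite (reindex_onto (grid_up k) (grid_down k)); last exact: grid_downK.
by apply: eq_bigl => z; rewrite grid_upK.
Qed.

(** The signed mass on the left is the divergence of the flow K g in direction
    k: K does not vary along k, and g vanishes at both ends, so no boundary
    term remains. *)
Lemma summation_by_parts (R : pzRingType) k (K theta : V -> R) (g : nat -> R) :
  (forall z, K (grid_up k z) = K z) -> g 0%N = 0 -> g N = 0 ->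
  \sum_(z : V) K z * (g (z k) - g (z k).+1) * theta z =
  \sum_(z : V | ((z k).+1 < N)%N) K z * g (z k).+1 * (theta (grid_up k z) - theta z).
Proof.
move=> KE g0 gN.
under eq_bigr do rewrite mulrBr mulrBl.
under [RHS]eq_bigr do rewrite mulrBr.
rewrite !sumrB; congr (_ - _).
  rewrite (bigID (fun z : V => 0 < z k)%N)/= [X in _ + X]big1 ?addr0; last first.
    by move=> z; rewrite lt0n negbK => /eqP ->; rewrite g0 mulr0 mul0r.
  rewrite reindex_grid_up; apply: eq_bigr => z zN.
  by rewrite KE (grid_upE _ zN) eqxx addn1.
rewrite (bigID (fun z : V => (z k).+1 < N)%N)/= [X in _ + X]big1 ?addr0//.
move=> z zN; have -> : (z k).+1 = N by have := ltn_ord (z k); lia.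
by rewrite gN mulr0 mul0r.
Qed.

End grid_shift.

(** * A multiscale flow from a vertex to the uniform distribution *)

(** A weighted Cauchy-Schwarz inequality for the weights 2^-j, whose sum is at
    most 2: peel off the first term and use (a + b)^2 <= 2 a^2 + 2 b^2. *)
Lemma sqr_sum_geometric (R : realFieldType) (J : nat) (a : nat -> R) :
  (\sum_(j < J) a j) ^+ 2 <= 2 * \sum_(j < J) 2 ^+ j * a j ^+ 2.
Proof.
elim: J a => [|J IHJ] a; first by rewrite !big_ord0 expr0n mulr0.
rewrite !big_ord_recl /= expr0 mul1r.
have := IHJ (fun j => a j.+1).
have -> : \sum_(i < J) 2 ^+ bump 0 i * a (bump 0 i) ^+ 2 =
          2 * \sum_(i < J) 2 ^+ i * a i.+1 ^+ 2.
  by rewrite mulr_sumr; apply: eq_bigr => i _; rewrite /bump leq0n add1n exprS mulrA.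
under eq_bigr do rewrite /bump leq0n add1n.
set s := \sum_(_ < J) _; set t := \sum_(_ < J) _ => IH.
have := sqr_ge0 (a 0 - s); nra.
Qed.

Lemma telescope_sum_ord (V : zmodType) (f : nat -> V) n :
  \sum_(k < n) (f k - f k.+1) = f 0%N - f n.
Proof.
elim: n => [|n IHn]; first by rewrite big_ord0 subrr.
by rewrite big_ord_recr /= IHn addrA subrK.
Qed.

Section flow.
Variables (R : realFieldType) (d N : nat).
Hypothesis N_gt0 : (0 < N)%N.
Local Notation V := (grid_vertex d N).
Implicit Types (j J : nat) (k : 'I_d) (x z : V).

(** Ratio 4 between consecutive sides makes the contribution 4^-j of scale j
    to the squared flow beat the weights 2^j of sqr_sum_geometric. *)
Definition side j : nat := minn (4 ^ j) N.

Lemma side_bounds j : (0 < side j <= N)%N.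
Proof. rewrite /side; have := expn_gt0 4 j; lia. Qed.

Lemma leq_sideS j : (side j <= side j.+1)%N.
Proof. rewrite /side expnS; lia. Qed.

Lemma sideS_leq j : (side j.+1 <= 4 * side j)%N.
Proof. rewrite /side expnS; lia. Qed.

Definition side_mass j (x z : nat) : R := window_mass R N (side j) x z.

(** Product law around x whose first k coordinates are already spread at scale
    j + 1 while the others are still spread at scale j; it interpolates
    between the boxes of scales j and j + 1. *)
Definition hybrid j (k : nat) x z : R :=
  \prod_(i < d) side_mass (j + (i < k)) (x i) (z i).

(** Flow through the edge (k, z) that turns the k-th hybrid of scale j into
    the next one. *)
Definition level_flow j k x z : R :=
  (\prod_(i < d | i != k) side_mass (j + (i < k)%N) (x i) (z i)) *
  (window_cdf R N (side j.+1) (x k) (z k).+1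
   - window_cdf R N (side j) (x k) (z k).+1).

(** Consecutive hybrids differ in one coordinate, so the transport between
    them is one-dimensional. *)
Lemma hybrid_step j k x (theta : V -> R) :
  \sum_z (hybrid j k x z - hybrid j k.+1 x z) * theta z =
  \sum_(z | grid_edge (k, z))
     level_flow j k x z * (theta (grid_up k z) - theta z).
Proof.
pose K z := \prod_(i < d | i != k) side_mass (j + (i < k)%N) (x i) (z i).
pose g t := window_cdf R N (side j.+1) (x k) t - window_cdf R N (side j) (x k) t.
rewrite -(@summation_by_parts d N R k K theta g).
- apply: eq_bigr => z _; congr (_ * _).
  have -> : hybrid j k x z = side_mass j (x k) (z k) * K z.
    by rewrite /hybrid (bigD1 k)//= ltnn addn0.
  have -> : hybrid j k.+1 x z = side_mass j.+1 (x k) (z k) * K z.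
    rewrite /hybrid (bigD1 k)//= ltnSn addn1; congr (_ * _).
    by apply: eq_bigr => i /negbTE ik; rewrite ltnS leq_eqVlt (inj_eq val_inj) ik.
  rewrite /g /side_mass /window_mass; ring.
- by move=> z; apply: eq_bigr => i ik; rewrite grid_up_neq.
- by rewrite /g !window_cdf0 subr0.
- by rewrite /g !window_cdf_full ?side_bounds// subrr.
Qed.

Lemma hybrid_telescope J (theta : V -> R) x :
  \sum_z (hybrid 0 0 x z - hybrid J 0 x z) * theta z =
  \sum_(k < d) \sum_(z | grid_edge (k, z))
     (\sum_(j < J) level_flow j k x z) * (theta (grid_up k z) - theta z).
Proof.
have hyb0 j z : hybrid j d x z = hybrid j.+1 0 x z.
  by apply: eq_bigr => i _; rewrite ltn_ord addn1 addn0.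
transitivity (\sum_(j < J) \sum_(k < d)
    \sum_z (hybrid j k x z - hybrid j k.+1 x z) * theta z).
  under [RHS]eq_bigr do rewrite exchange_big.
  rewrite exchange_big; apply: eq_bigr => z _.
  under eq_bigr => j _.
    rewrite -mulr_suml (telescope_sum_ord (fun k : nat => hybrid j k x z)) hyb0; over.
  by rewrite -mulr_suml (telescope_sum_ord (fun j => hybrid j 0 x z)).
rewrite exchange_big; apply: eq_bigr => k _.
under eq_bigr do rewrite hybrid_step.
by rewrite exchange_big; apply: eq_bigr => z _; rewrite mulr_suml.
Qed.

(** Scale 0 is the point mass at x and scale J the uniform law on the grid, so
    the telescoping sum is theta(x) minus the mean. *)
Lemma flow_decomposition J (theta : V -> R) x : (N <= 4 ^ J)%N ->
  theta x - (N ^ d)%:R^-1 * \sum_z theta z =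
  \sum_(k < d) \sum_(z | grid_edge (k, z))
     (\sum_(j < J) level_flow j k x z) * (theta (grid_up k z) - theta z).
Proof.
move=> NJ; rewrite -hybrid_telescope.
under [RHS]eq_bigr do rewrite mulrBl.
rewrite sumrB mulr_sumr; congr (_ - _).
  rewrite (bigD1 x)//= big1 ?addr0.
    rewrite /hybrid big1 ?mul1r// => i _.
    rewrite /side_mass /side expn0 (minn_idPl _)// window_mass1 ?ltn_ord//.
    by rewrite eqxx.
  move=> z zx; have [i /negP xzi] : exists i, ~ x i == z i.
    apply/existsNP => xz; move/negP: zx; apply; apply/eqP/ffunP => i.
    by apply/esym/eqP/xz.
  rewrite /hybrid (bigD1 i)//= /side_mass /side expn0 (minn_idPl _)//.
  by rewrite window_mass1 ?ltn_ord// (inj_eq val_inj) (negbTE xzi) !mul0r.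
apply: eq_bigr => z _; congr (_ * _); rewrite /hybrid.
under eq_bigr => i _.
  rewrite addn0 /side_mass /side (minn_idPr _)// window_massN ?ltn_ord//; over.
by rewrite prodr_const card_ord natrX exprVn.
Qed.

(** The factors of a hybrid belong to scale j or j + 1.  Since sides increase,
    the smaller side bounds the mass and the larger one the reach in both
    cases. *)
Lemma side_mass_sqr_le j j' (x0 z0 : nat) : (x0 < N)%N -> (j <= j' <= j.+1)%N ->
  side_mass j' x0 z0 ^+ 2 <= (in_reach (side j.+1) x0 z0)%:R * ((side j)%:R^-1) ^+ 2.
Proof.
move=> x0N jj'.
have h1 : (side j <= side j' <= side j.+1)%N.
  have [->|->] : j' = j \/ j' = j.+1 by lia.
    by rewrite leqnn leq_sideS.
  by rewrite leq_sideS leqnn.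
have s0 := side_bounds j; have s1 := side_bounds j'.
have [nr|nr] := boolP (in_reach _ _ _); last first.
  rewrite /side_mass window_mass_in_reach ?expr0n ?mul0r//.
  by apply: contra nr; rewrite /in_reach; lia.
rewrite mul1r lerXn2r ?nnegrE ?invr_ge0 ?window_mass_ge0//.
apply: le_trans (window_mass_le _ _ _ _ _) _.
rewrite lef_pV2 ?posrE ?ltr0n ?ler_nat; lia.
Qed.

(** Each of the d - 1 coordinates other than k contributes a factor of order
    (1 / L)^2 to the square of the flow, and each of the d coordinates a number
    of points x of order L, where L is the side at scale j; the total is
    L^(2 - d) up to constants, which is at most 1 / L because d >= 3. *)
Lemma level_flow_sqr_sum j k z : (3 <= d)%N ->
  \sum_x level_flow j k x z ^+ 2 <= 8 ^+ d / (side j)%:R.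
Proof.
move=> d3; have /andP[s0 sN] := side_bounds j.
have /andP[_ s1N] := side_bounds j.+1.
pose q : R := (side j)%:R^-1.
have q0 : 0 < q by rewrite invr_gt0 ltr0n.
have q1 : q <= 1 by rewrite invf_le1 ?ltr0n// ler1n.
pose phi (i : 'I_d) (a : 'I_N) : R :=
  (in_reach (side j.+1) a (z i))%:R * (if i == k then 1 else q ^+ 2).
have phi_le (i : 'I_d) : \sum_a phi i a <=
    8 * (if i == k then q^-1 else q).
  rewrite -mulr_suml -natr_sum.
  have -> : (\sum_(a < N) in_reach (side j.+1) a (z i))%N =
      #|[pred a : 'I_N | in_reach (side j.+1) a (z i)]|.
    by rewrite -sum1_card [RHS]big_mkcond/=; apply: eq_bigr => a _; rewrite inE; case: in_reach.
  apply: (@le_trans _ _ (8 * q^-1 * (if i == k then 1 else q ^+ 2))).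
    rewrite ler_wpM2r//; first by case: ifP => // _; rewrite sqr_ge0.
    rewrite invrK -natrM ler_nat (leq_trans (card_in_reach _ _ _))//.
    have := sideS_leq j; lia.
  case: ifP => _; first by rewrite mulr1.
  by rewrite expr2 -mulrA mulKf// gt_eqF.
apply: (@le_trans _ _ (\sum_(x : V) \prod_(i < d) phi i (x i))).
  apply: ler_sum => x _; rewrite /level_flow exprMn [leRHS](bigD1 k)//= mulrC.
  apply: ler_pM; rewrite ?sqr_ge0//.
    rewrite /phi eqxx mulr1 -real_normK ?num_real//.
    have := window_cdf_diff R (z k) s0 (leq_sideS j) s1N (ltn_ord (x k)).
    case: in_reach => /= h; first by rewrite exprn_ile1.
    by rewrite expr2 mulr_ge0_le0.
  rewrite -prodrXl; apply: ler_prod => i ik.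
  rewrite sqr_ge0/= /phi (negbTE ik); apply: side_mass_sqr_le => //.
  by case: (i < k)%N; lia.
rewrite -[X in X <= _](bigA_distr_bigA (fun i a => phi i a)) /=.
apply: (@le_trans _ _ (\prod_(i < d) (8 * (if i == k then q^-1 else q)))).
  apply: ler_prod => i _; rewrite phi_le andbT.
  apply: sumr_ge0 => a _; rewrite /phi mulr_ge0//.
  by case: ifP => // _; rewrite sqr_ge0.
rewrite big_split/= prodr_const card_ord ler_wpM2l ?exprn_ge0//.
rewrite (bigD1 k)//= eqxx.
rewrite (eq_bigr (fun=> q)); last by move=> i /negbTE ->.
rewrite prodr_const (_ : #|_| = d.-1); last first.
  by rewrite cardC1 card_ord.
case: d d3 => [//|[//|[//|d']]] _ /=.
rewrite exprS mulKf ?gt_eqF// exprS ger_pMr//.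
by rewrite exprn_ile1// ltW.
Qed.

(** The sum over scales of the bound of level_flow_sqr_sum, against the
    weights 2^j, is a geometric series of ratio 1 / 2. *)
Lemma flow_sqr_sum J k z : (3 <= d)%N -> (forall j, (j < J)%N -> (4 ^ j <= N)%N) ->
  \sum_x (\sum_(j < J) level_flow j k x z) ^+ 2 <= 4 * 8 ^+ d.
Proof.
move=> d3 JN.
apply: (@le_trans _ _ (\sum_(x : V) 2 * \sum_(j < J) 2 ^+ j * level_flow j k x z ^+ 2)).
  by apply: ler_sum => x _; apply: (sqr_sum_geometric J (fun j => level_flow j k x z)).
rewrite -mulr_sumr exchange_big /=.
apply: (@le_trans _ _ (2 * \sum_(j < J) 8 ^+ d * 2^-1 ^+ j)).
  rewrite ler_pM2l//; apply: ler_sum => j _; rewrite -mulr_sumr.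
  apply: (@le_trans _ _ (2 ^+ j * (8 ^+ d / (side j)%:R))).
    by rewrite ler_pM2l ?exprn_gt0// level_flow_sqr_sum.
  rewrite /side (minn_idPl (JN _ _))// natrX.
  rewrite mulrCA ler_pM2l ?exprn_gt0// exprVn.
  rewrite (_ : 4%:R = 2 * 2 :> R); last by rewrite -natrM.
  by rewrite exprMn invfM mulVKf ?expf_neq0.
rewrite -mulr_sumr (_ : 4 = 2 * 2 :> R); last by rewrite -natrM.
rewrite -mulrA ler_pM2l// mulrC ler_pM2r ?exprn_gt0//.
have -> : forall J', \sum_(j < J') 2^-1 ^+ j = 2 - 2 * 2^-1 ^+ J' :> R.
  elim=> [|J' IH]; first by rewrite big_ord0 expr0; lra.
  rewrite big_ord_recr /= IH exprS; lra.
by rewrite gerBl mulr_ge0// exprn_ge0.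
Qed.

(** The number of scales is the least J with 4^J >= N, so that at every scale
    below J the side is exactly 4^j. *)
Lemma bounded_flow : (3 <= d)%N ->
  exists W : 'I_d * V -> V -> R,
    (forall theta x, theta x - (N ^ d)%:R^-1 * \sum_z theta z =
       \sum_(p | grid_edge p) W p x * (theta (grid_up p.1 p.2) - theta p.2)) /\
    (forall p, \sum_x W p x ^+ 2 <= 4 * 8 ^+ d).
Proof.
move=> d3; have exJ : exists J, (N <= 4 ^ J)%N by exists N; exact/ltnW/ltn_expl.
case: (ex_minnP exJ) => J NJ Jmin.
exists (fun p x => \sum_(j < J) level_flow j p.1 x p.2); split.
  move=> theta x; rewrite (flow_decomposition _ _ NJ) pair_big_dep /=.
  by apply: eq_big => [[k z]|[k z] _].
move=> p; apply: flow_sqr_sum => // j jJ; rewrite leqNgt; apply/negP => /ltnW /Jmin.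
lia.
Qed.

End flow.

(** * The incidence matrix *)

Section edges.
Variables (d N : nat).
Local Notation V := (grid_vertex d N).
Implicit Types (x y z : V) (k : 'I_d).

Definition edge_ends (p : 'I_d * V) : {set V} := [set p.2; grid_up p.1 p.2]%SET.

Lemma differ_by_basisP x y :
  reflect (exists2 k, grid_edge (k, y) & x = grid_up k y) (differ_by_basis x y).
Proof.
apply: (iffP existsP) => -[k].
  move=> /forallP xy; have yN : grid_edge (k, y).
    have := xy k; rewrite eqxx /= => /eqP h; have := ltn_ord (x k).
    by rewrite /grid_edge /=; lia.
  exists k => //; apply/ffunP => i; apply/val_inj => /=; rewrite grid_upE//.
  by have /eqP := xy i; case: (i == k) => /=; lia.
move=> yN ->; exists k; apply/forallP => i; rewrite grid_upE//.
by case: (i == k) => /=; lia.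
Qed.

Lemma edge_ends_in (p : 'I_d * V) : grid_edge p -> edge_ends p \in grid_edges d N.
Proof.
case: p => k z zN; apply/imsetP; exists (z, grid_up k z) => //.
rewrite inE /= /grid_adj; apply/orP; right.
by apply/differ_by_basisP; exists k.
Qed.

(** If the lower endpoint of one edge were the upper endpoint of the other and
    conversely, the coordinate in the direction of the first edge would be
    strictly less than itself; so the lower endpoints agree. *)
Lemma edge_ends_inj (p q : 'I_d * V) : grid_edge p -> grid_edge q ->
  edge_ends p = edge_ends q -> p = q.
Proof.
case: p q => k z [k' z']; rewrite /edge_ends /= => zN z'N E.
have le_up i : (z i <= grid_up k z i)%N by rewrite grid_upE// leq_addr.
have le_up' i : (z' i <= grid_up k' z' i)%N by rewrite grid_upE// leq_addr.
have ltk : (z k < grid_up k z k)%N by rewrite grid_upE// eqxx addn1.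
have /set2P zz' : z \in [set z'; grid_up k' z']%SET by rewrite -E set21.
have /set2P uz' : grid_up k z \in [set z'; grid_up k' z']%SET by rewrite -E set22.
case: zz' => [zz'|zz'].
  case: uz' => [uz'|]; first by move: ltk; rewrite uz' -zz' ltnn.
  rewrite -zz' => /ffunP/(_ k)/(congr1 val)/=.
  move: z'N; rewrite -zz' => z'N; rewrite !grid_upE// eqxx => kk'.
  by congr (_, _); apply/eqP; move: kk'; case: (k == k') => //; lia.
have := le_up' k; rewrite -zz'; case: uz' => uz'; last by move: ltk; rewrite uz' zz' ltnn.
by move: ltk; rewrite uz'; lia.
Qed.

Lemma grid_edgesP (a b : V) : [set a; b]%SET \in grid_edges d N ->
  exists p, [/\ grid_edge p, edge_ends p = [set a; b]%SET
    & (a = p.2 /\ b = grid_up p.1 p.2) \/ (b = p.2 /\ a = grid_up p.1 p.2)].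
Proof.
move=> /imsetP[[x y]]; rewrite inE /= => /orP adj abE.
have [p [pe pE]] : exists p : 'I_d * V, grid_edge p /\ edge_ends p = [set a; b]%SET.
  case: adj => /differ_by_basisP[k kN E].
    by exists (k, y); split => //; rewrite abE /edge_ends /= E finset.setUC.
  by exists (k, x); split => //; rewrite abE /edge_ends /= E.
exists p; split => //.
have neq : p.2 != grid_up p.1 p.2.
  apply/eqP => /ffunP/(_ p.1)/(congr1 (@nat_of_ord N)); rewrite grid_upE// eqxx addn1; exact: n_Sn.
have /set2P p2 : p.2 \in [set a; b]%SET by rewrite -pE set21.
have /set2P pu : grid_up p.1 p.2 \in [set a; b]%SET by rewrite -pE set22.
by case: p2 pu neq => -> [] ->; rewrite ?eqxx//; [left|right].
Qed.

End edges.

(** The rows of D are enumerated by the pairs (direction, lower endpoint), with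
    v and u mutually inverse numberings of the vertices; the arbitrary
    orientation of row j is recorded in the sign s j. *)
Lemma grid_incidence_edges (R : realType) (d N m : nat)
    (D : 'M[R]_(m, (N ^ d)%N)) : grid_incidence D ->
  exists (v : 'I_(N ^ d) -> grid_vertex d N) (u : grid_vertex d N -> 'I_(N ^ d))
    (p : 'I_m -> 'I_d * grid_vertex d N) (s : 'I_m -> R),
  [/\ cancel v u, cancel u v, injective p, (forall q, grid_edge q = (q \in codom p))
    & forall j, s j ^+ 2 = 1 /\ forall theta : 'cV[R]_(N ^ d),
        (D *m theta) j 0 =
        s j * (theta (u (grid_up (p j).1 (p j).2)) 0 - theta (u (p j).2) 0)].
Proof.
case=> v [e [[u vK uK] e_inj e_codom De]].
have edgeP j : exists ps : ('I_d * grid_vertex d N) * R,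
   [/\ grid_edge ps.1, edge_ends ps.1 = e j, ps.2 ^+ 2 = 1
    & forall theta : 'cV[R]_(N ^ d), (D *m theta) j 0 =
        ps.2 * (theta (u (grid_up ps.1.1 ps.1.2)) 0 - theta (u ps.1.2) 0)].
  have [a [b [ab ejE Da Db D0]]] := De j.
  have Dtheta (theta : 'cV[R]_(N ^ d)) :
      (D *m theta) j 0 = theta a 0 - theta b 0.
    rewrite mxE (bigD1 a)//= (bigD1 b)/=; last by rewrite eq_sym.
    rewrite big1 ?addr0 ?Da ?Db ?mul1r ?mulN1r// => i /andP[ia ib].
    by rewrite D0 ?mul0r.
  have ej : e j \in grid_edges d N by rewrite -e_codom codom_f.
  rewrite ejE in ej; have [p [pe pE H]] := grid_edgesP ej.
  case: H => -[h1 h2].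
    exists (p, -1); split; rewrite ?ejE ?sqrrN ?expr1n//= => theta.
    by rewrite Dtheta -h2 -h1 !vK mulN1r opprB.
  exists (p, 1); split; rewrite ?ejE ?expr1n//= => theta.
  by rewrite Dtheta -h2 -h1 !vK mul1r.
have [f fP] := choice edgeP.
exists v, u, (fun j => (f j).1), (fun j => (f j).2); split => //.
- move=> i j ij; apply: e_inj.
  by have [_ <- _ _] := fP i; have [_ <- _ _] := fP j; rewrite ij.
- move=> q; apply/idP/codomP => [qe|[j ->]]; last by have [] := fP j.
  have := edge_ends_in qe; rewrite -e_codom => /codomP[j ejE].
  by exists j; have [pe pE _ _] := fP j; apply: edge_ends_inj; rewrite ?pE.
- by move=> j; have [_ _ s1 H] := fP j.
Qed.

Lemma big_codom_inj (T : finType) (I : finType) (W : nmodType) (P : pred T)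
   (p : I -> T) (F : T -> W) : injective p -> (forall q, P q = (q \in codom p)) ->
  \sum_(q | P q) F q = \sum_j F (p j).
Proof.
move=> pinj pP; rewrite (eq_bigl (fun q => q \in [set p j | j in [set: I]]%SET)); last first.
  move=> q; rewrite pP; apply/codomP/imsetP => [[j ->]|[j _ ->]]; first by exists j.
  by exists j.
by rewrite big_imset /=; [apply: eq_bigl => j; rewrite inE|move=> i j _ _; apply: pinj].
Qed.

(** A flow from x to the uniform distribution is row x of a matrix S such that
    S D is the identity minus averaging.  The bound on the columns does not
    depend on N. *)
Lemma grid_right_inverse (R : realType) (d N m : nat)
    (D : 'M[R]_(m, (N ^ d)%N)) : (3 <= d)%N -> (0 < N)%N -> grid_incidence D ->
  exists S : 'M[R]_((N ^ d)%N, m),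
    (forall (theta : 'cV[R]_(N ^ d)) i,
       theta i 0 - (N ^ d)%:R^-1 * \sum_i' theta i' 0 =
       \sum_j S i j * (D *m theta) j 0) /\
    (forall j, \sum_i S i j ^+ 2 <= 4 * 8 ^+ d).
Proof.
move=> d3 N0 /grid_incidence_edges[v [u [p [s [vK uK pinj pP Dp]]]]].
have [W [WE Wle]] := bounded_flow R N0 d3.
exists (\matrix_(i, j) (s j * W (p j) (v i))); split.
  move=> theta i; have -> : \sum_i' theta i' 0 = \sum_z theta (u z) 0.
    by rewrite (reindex u)//; exists v => ? _.
  have := WE (fun z => theta (u z) 0) (v i); rewrite vK => ->.
  rewrite (big_codom_inj _ pinj pP); apply: eq_bigr => j _.
  by have [s1 ->] := Dp j; rewrite mxE mulrACA -expr2 s1 mul1r.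
move=> j; have [s1 _] := Dp j.
under eq_bigr do rewrite mxE exprMn s1 mul1r.
apply: le_trans (Wle (p j)).
by rewrite [leRHS](reindex v)//; exists u => ? _.
Qed.

Lemma grid_edge_count (R : realType) (d N m : nat)
    (D : 'M[R]_(m, (N ^ d)%N)) : grid_incidence D -> (m <= d * N ^ d)%N.
Proof.
move=> /grid_incidence_edges[v [u [p [s [vK uK pinj pP Dp]]]]].
have := leq_card p pinj; rewrite card_ord card_prod card_ord.
by rewrite card_ffun !card_ord.
Qed.

(** A vertex has at most 2 d neighbours, and (a - b)^2 <= 2 a^2 + 2 b^2. *)
Lemma grid_gradient_sqr (R : realType) (d N m : nat)
    (D : 'M[R]_(m, (N ^ d)%N)) (theta : 'cV[R]_(N ^ d)) : grid_incidence D ->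
  norm2_sq (D *m theta) <= 4 * d%:R * norm2_sq theta.
Proof.
move=> /grid_incidence_edges[v [u [p [s [vK uK pinj pP Dp]]]]].
pose f z := theta (u z) 0.
have -> : norm2_sq theta = \sum_z f z ^+ 2.
  by rewrite /norm2_sq (reindex u)//; exists v => ? _.
apply: (@le_trans _ _ (\sum_k \sum_(z | grid_edge (k, z))
     (2 * f (grid_up k z) ^+ 2 + 2 * f z ^+ 2))).
  rewrite pair_big_dep /=.
  rewrite (eq_bigl (fun q => grid_edge q)); last by case.
  rewrite (big_codom_inj _ pinj pP); apply: ler_sum => j _.
  have [s1 ->] := Dp j; rewrite exprMn s1 mul1r -/(f _) -/(f _).
  have := sqr_ge0 (f (grid_up (p j).1 (p j).2) + f (p j).2); nra.
apply: (@le_trans _ _ (\sum_(k < d) 4 * \sum_z f z ^+ 2)); last first.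
  by rewrite sumr_const card_ord -mulrnAl -mulr_natr.
apply: ler_sum => k _; rewrite big_split /= -!mulr_sumr.
have h1 : \sum_(z | grid_edge (k, z)) f (grid_up k z) ^+ 2 <= \sum_z f z ^+ 2.
  rewrite -(@reindex_grid_up d N _ k (fun z => f z ^+ 2)).
  rewrite [leRHS](bigID (fun z : grid_vertex d N => 0 < z k)%N) /=.
  by rewrite lerDl sumr_ge0// => z _; rewrite sqr_ge0.
have h2 : \sum_(z | grid_edge (k, z)) f z ^+ 2 <= \sum_z f z ^+ 2.
  rewrite [leRHS](bigID (fun z => grid_edge (k, z))) /=.
  by rewrite lerDl sumr_ge0// => z _; rewrite sqr_ge0.
lra.
Qed.

(** * Integration against an image measure *)

Section weighted_integral.
Context d1 d2 (X : measurableType d1) (Y : measurableType d2) (R : realType).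
Variables (mu : {measure set X -> \bar R}) (nu : {measure set Y -> \bar R}).
Variables (phi : X -> Y) (h : X -> R) (c : R).
Hypotheses (mphi : measurable_fun [set: X] phi) (mh : measurable_fun [set: X] h).
Hypothesis h_ge0 : forall x, 0 <= h x.
Hypothesis indicE : forall A, measurable A ->
  (\int[mu]_x (h x * \1_A (phi x))%:E = c%:E * nu A)%E.

Import HBNNSimple.

Let mhf (f : Y -> R) : measurable_fun [set: Y] f ->
  measurable_fun [set: X] (fun x => (h x * f (phi x) : R)%:E).
Proof.
move=> mf; apply/measurable_EFinP; apply: measurable_funM => //.
exact: measurableT_comp.
Qed.

Let weighted_integral_nnsfun (f : {nnsfun Y >-> R}) :
  (\int[mu]_x (h x * f (phi x))%:E = c%:E * \int[nu]_y (f y)%:E)%E.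
Proof.
have mi r : measurable_fun [set: Y] (fun y => r * \1_(f @^-1` [set r]) y).
  by apply: measurable_funM => //; exact: measurable_indic.
have r0 r y : 0 <= r * \1_(f @^-1` [set r]) y.
  by rewrite -lee_fin EFinM; exact: nnfun_muleindic_ge0.
rewrite [RHS](_ : _ = c%:E * \sum_(r \in range f) r%:E * nu (f @^-1` [set r]))%E;
  last first.
  congr (_ * _)%E; under eq_integral do rewrite fimfunE -fsumEFin//.
  rewrite ge0_integral_fsum//=; last first.
  - by move=> r y _; rewrite lee_fin.
  - by move=> r; exact/measurable_EFinP.
  apply: eq_fsbigr => r _; rewrite integralZl_indic_nnsfun//.
  by rewrite integral_indic// setIT.
have -> : (fun x => (h x * f (phi x))%:E) =
    (fun x => \sum_(r \in range f) (h x * (r * \1_(f @^-1` [set r]) (phi x)))%:E)%E.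
  apply/funext => x; rewrite fsumEFin//; congr (_%:E).
  by rewrite {1}fimfunE !fsbig_finite// mulr_sumr.
rewrite ge0_integral_fsum//=; last first.
- by move=> r x _; rewrite lee_fin mulr_ge0.
- by move=> r; exact: (mhf (mi r)).
rewrite ge0_mule_fsumr; last first.
  move=> r; have [rf|] := pselect (range f r).
    by case: rf => y _ <-; rewrite mule_ge0// lee_fin.
  by move=> /preimage10 ->; rewrite measure0 mule0.
apply: eq_fsbigr => r /[!inE] -[y _ fyr].
have r0' : 0 <= r by rewrite -fyr.
under eq_integral do rewrite mulrCA EFinM.
rewrite ge0_integralZl//.
- by rewrite indicE// muleCA.
- by apply: mhf; exact: measurable_indic.
- by move=> x _; rewrite lee_fin mulr_ge0.
Qed.

(** The set functions sending A to the integral of h times the indicator of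
    phi^-1(A), and to c nu(A), agree; hence so do the integrals against them,
    by approximation with simple functions.  It serves both for densities (phi
    the identity) and to integrate out one coordinate of an independent
    family (h the product of the others). *)
Lemma weighted_integral (f : Y -> R) : measurable_fun [set: Y] f ->
  (forall y, 0 <= f y) ->
  (\int[mu]_x (h x * f (phi x))%:E = c%:E * \int[nu]_y (f y)%:E)%E.
Proof.
move=> mf f0; have mfE : measurable_fun [set: Y] (EFin \o f).
  exact/measurable_EFinP.
pose f_ := nnsfun_approx measurableT mfE.
have f_cvg y : (EFin \o f_^~ y) @ \oo --> (f y)%:E.
  by apply: (@cvg_nnsfun_approx _ _ _ _ measurableT _ mfE) => // t _; rewrite lee_fin.
have f_nd y m n : (m <= n)%N -> f_ m y <= f_ n y.
  by move=> mn; exact/lefP/nd_nnsfun_approx.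
have <- : (limn (fun n => \int[mu]_x (h x * f_ n (phi x))%:E) =
    \int[mu]_x (h x * f (phi x))%:E)%E.
  rewrite -monotone_convergence//=.
  - apply: eq_integral => x _; apply/cvg_lim => //.
    under eq_fun do rewrite EFinM.
    rewrite EFinM; apply: cvgeZl => //; exact: f_cvg.
  - by move=> n; exact: mhf.
  - by move=> n x _; rewrite lee_fin mulr_ge0.
  - by move=> x _ m n mn; rewrite lee_fin ler_wpM2l// f_nd.
have -> : (\int[nu]_y (f y)%:E = limn (fun n => \int[nu]_y (f_ n y)%:E))%E.
  rewrite -monotone_convergence//=.
  - by apply: eq_integral => y _; apply/esym/cvg_lim => //; exact: f_cvg.
  - by move=> n; exact/measurable_EFinP.
  - by move=> n y _; rewrite lee_fin.
  - by move=> y _ m n mn; rewrite lee_fin f_nd.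
under eq_fun do rewrite weighted_integral_nnsfun.
rewrite limeMl//.
apply: ereal_nondecreasing_is_cvgn => m n mn; apply: ge0_le_integral => //=.
- by move=> y _; rewrite lee_fin.
- exact/measurable_EFinP.
- exact/measurable_EFinP.
- by move=> y _; rewrite lee_fin f_nd.
Qed.

End weighted_integral.

(** * Gaussian noise *)

Lemma ge0_integral_normal_prob (R : realType) (m s : R) (f : R -> R) :
  measurable_fun [set: R] f -> (forall x, 0 <= f x) ->
  (\int[normal_prob m s]_x (f x)%:E =
   \int[lebesgue_measure]_x (normal_pdf m s x * f x)%:E)%E.
Proof.
move=> mf f0; rewrite (@weighted_integral _ _ _ _ _ lebesgue_measure
  (normal_prob m s) id (normal_pdf m s) 1) ?mul1e//.
- exact: measurable_normal_pdf.
- exact: normal_pdf_ge0.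
- move=> A mA; rewrite mul1e /normal_prob [RHS]integral_mkcond.
  apply: eq_integral => x _; rewrite patchE indicE /=.
  by case: (x \in A); rewrite ?mulr1 ?mulr0.
Qed.

(** Completing the square: exp(t x) times the density of N(0, s^2) is
    exp(s^2 t^2 / 2) times the density of N(s^2 t, s^2). *)
Lemma normal_mgf (R : realType) (s t : R) : s != 0 ->
  (\int[normal_prob 0 s]_x (expR (t * x))%:E = (expR (s ^+ 2 * t ^+ 2 / 2))%:E)%E.
Proof.
move=> s0; rewrite ge0_integral_normal_prob; last 2 first.
- by apply: measurableT_comp => //; exact: measurable_funM.
- by move=> x; exact: expR_ge0.
rewrite -[RHS]mule1 -(integral_normal_pdf (s ^+ 2 * t) s) -ge0_integralZl//=; last 2 first.
- by apply/measurable_EFinP; exact: measurable_normal_pdf.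
- by move=> x _; rewrite lee_fin normal_pdf_ge0.
apply: eq_integral => x _; rewrite -EFinM; congr (_%:E).
rewrite !normal_pdfE// /normal_fun [RHS]mulrCA -[LHS]mulrA; congr (_ * _).
rewrite -!expRD; congr expR; field.
by rewrite s0.
Qed.

Section independence.
Context (R : realType) (disp : measure_display) (Omega : measurableType disp).
Variables (P : probability Omega R) (n : nat) (X : 'I_n -> {RV P >-> R}).
Hypothesis indep : forall A : 'I_n -> set R, (forall i, measurable (A i)) ->
     P (\bigcap_(i in [set: 'I_n]) (X i @^-1` A i)) =
     (\prod_(i < n) P (X i @^-1` A i))%E.

(** The product rule for events is the case where every g i is an indicator;
    indicators are replaced by general functions one index at a time, the
    other factors serving as a weight. *)
Lemma indep_expectation_prod (g : 'I_n -> R -> R) (c : 'I_n -> R) :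
  (forall i, measurable_fun [set: R] (g i)) -> (forall i x, 0 <= g i x) ->
  (forall i, (\int[P]_w (g i (X i w))%:E = (c i)%:E)%E) ->
  (\int[P]_w (\prod_i g i (X i w))%:E = (\prod_i c i)%:E)%E.
Proof.
move=> mg g0 gc.
have c0 i : 0 <= c i by rewrite -lee_fin -gc integral_ge0// => w _; rewrite lee_fin.
pose G k (A : 'I_n -> set R) (i : 'I_n) : R -> R :=
  if (i < k)%N then g i else \1_(A i).
pose C k (A : 'I_n -> set R) (i : 'I_n) : R :=
  if (i < k)%N then c i else fine (P (X i @^-1` A i)).
have G0 k A i x : 0 <= G k A i x by rewrite /G; case: ifP.
have C0 k A i : 0 <= C k A i by rewrite /C; case: ifP => // _; rewrite fine_ge0.
have mX i : measurable_fun [set: Omega] (X i) by [].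
have mG k A i : (forall i, measurable (A i)) -> measurable_fun [set: R] (G k A i).
  by move=> mA; rewrite /G; case: ifP => // _; exact: measurable_indic.
have step k A : (k <= n)%N -> (forall i, measurable (A i)) ->
    (\int[P]_w (\prod_i G k A i (X i w))%:E = (\prod_i C k A i)%:E)%E.
  elim: k A => [|k IHk] A kn mA.
    transitivity (\int[P]_w (\1_(\bigcap_(i in [set: 'I_n]) (X i @^-1` A i)) w)%:E)%E.
      apply: eq_integral => w _; congr (_%:E); rewrite indicE.
      have [wA|wA] := boolP (_ \in _).
        rewrite big1// => i _; rewrite /G ltn0 indicE mem_set//.
        by move: wA; rewrite inE => /(_ i); apply.
      have [i wi] : exists i, ~ A i (X i w).
        apply/existsNP => wA'; move: wA; rewrite notin_setE; apply => i _.
        exact: wA'.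
      by rewrite (bigD1 i)//= /G ltn0 indicE memNset// mul0r.
    have mXA i : measurable (X i @^-1` A i).
      by rewrite -[_ @^-1` _]setTI; exact: mX.
    rewrite integral_indic//; last first.
      by apply: fin_bigcap_measurable => // i _; exact: mXA.
    rewrite setIT -prodEFin; etransitivity; first exact: indep.
    apply: eq_bigr => i _.
    by rewrite /C ltn0 fineK// fin_num_measure.
  pose ik := Ordinal kn.
  have Gik : G k.+1 A ik = g ik by rewrite /G /= ltnSn.
  have Cik : C k.+1 A ik = c ik by rewrite /C /= ltnSn.
  have lt_ik i : i != ik -> (i < k.+1)%N = (i < k)%N.
    by move=> /negbTE; rewrite -val_eqE /= ltnS leq_eqVlt => ->.
  rewrite [in RHS](bigD1 ik)//= Cik.
  under eq_integral do rewrite (bigD1 ik)//= Gik mulrC.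
  set c' := \prod_(i < n | i != ik) _.
  rewrite (@weighted_integral _ _ _ _ _ P (distribution P (X ik)) (X ik)
    (fun w => \prod_(i < n | i != ik) G k.+1 A i (X i w)) c')//.
  - rewrite ge0_integral_distribution//=.
    + by rewrite gc -EFinM mulrC.
    + exact/measurable_EFinP.
    + by move=> y; rewrite lee_fin.
  - under eq_fun do rewrite -big_filter.
    apply: measurable_prod => i _; apply: measurableT_comp => //; exact: mG.
  - by move=> w; apply: prodr_ge0.
  (* Inserting an arbitrary B at index k recovers the induction hypothesis. *)
  - move=> B mB; pose A' i := if i == ik then B else A i.
    have mA' i : measurable (A' i) by rewrite /A'; case: ifP.
    have := IHk A' (ltnW kn) mA'; rewrite [in X in _ = X](bigD1 ik)//=.
    have -> : \prod_(i < n | i != ik) C k A' i = c'.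
      by apply: eq_bigr => i ii; rewrite /C lt_ik// /A' (negbTE ii).
    have -> : C k A' ik = fine (P (X ik @^-1` B)) by rewrite /C /= ltnn /A' eqxx.
    rewrite mulrC EFinM fineK; last first.
      by rewrite fin_num_measure// -[_ @^-1` _]setTI; exact: mX.
    move=> <-; apply: eq_integral => w _; congr (_%:E).
    have Gk : G k A' ik = \1_B by rewrite /G /= ltnn /A' eqxx.
    rewrite [RHS](bigD1 ik)//= Gk mulrC; congr (_ * _).
    by apply: eq_bigr => i ii; rewrite /G lt_ik// /A' (negbTE ii).
have := step n (fun=> setT) (leqnn n) (fun=> measurableT).
rewrite [in X in _ = X](eq_bigr c); last by move=> i _; rewrite /C ltn_ord.
move=> <-; apply: eq_integral => w _; congr (_%:E).
by apply: eq_bigr => i _; rewrite /G ltn_ord.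
Qed.

End independence.

Section gaussian_tail.
Context (R : realType) (disp : measure_display) (Omega : measurableType disp).
Variables (P : probability Omega R) (n : nat) (eps : 'I_n -> {RV P >-> R}).
Variable sigma : R.
Hypotheses (sigma_gt0 : 0 < sigma) (heps : gaussian_noise eps sigma).

Lemma measurable_linear_noise (s : 'I_n -> R) :
  measurable_fun [set: Omega] (fun w => \sum_i s i * eps i w).
Proof.
apply: measurable_sum => i; apply: measurable_funM => //.
Qed.

Lemma linear_noise_mgf (s : 'I_n -> R) (r : R) :
  (\int[P]_w (expR (r * \sum_i s i * eps i w))%:E =
   (expR (sigma ^+ 2 * r ^+ 2 / 2 * \sum_i s i ^+ 2))%:E)%E.
Proof.
have [law indep] := heps.
under eq_integral do rewrite mulr_sumr expR_sum.
rewrite mulr_sumr expR_sum.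
apply: (indep_expectation_prod indep (g := fun i x => expR (r * (s i * x)))).
- by move=> i; apply: measurableT_comp => //; apply: measurable_funM => //.
- by move=> i x; exact: expR_ge0.
move=> i; under eq_integral do rewrite mulrA -[expR _]mul1r.
rewrite (@weighted_integral _ _ _ (measurableTypeR R) _ P (normal_prob 0 sigma)
  (eps i) (fun=> 1) 1 _ _ _ _ (fun x => expR (r * s i * x)))//.
- by rewrite mul1e normal_mgf ?gt_eqF//; congr (expR _)%:E; ring.
- by move=> mD B mB; exact: (measurable_funP (D := setT) (eps i) mD B mB).
- move=> A mA; under eq_integral do rewrite mul1r.
  rewrite mul1e; transitivity (distribution P (eps i) A); last exact: law.
  rewrite (integral_indic _ _ (A := eps i @^-1` A))// ?setIT//.
  by rewrite -[_ @^-1` _]setTI; exact: (measurable_funP (D := setT) (eps i)).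
- by apply: measurableT_comp => //; exact: measurable_funM.
Qed.

(** Chernoff's inequality at the minimiser r = a / (sigma^2 v) of the Gaussian
    exponent. *)
Lemma linear_noise_upper_tail (s : 'I_n -> R) (v a : R) : 0 < v -> 0 < a ->
  \sum_i s i ^+ 2 <= v ->
  (P [set w | a <= \sum_i s i * eps i w]%R <=
    (expR (- (a ^+ 2 / (2 * sigma ^+ 2 * v))))%:E)%E.
Proof.
move=> v0 a0 sv.
pose X : {RV P >-> R} := mfun_Sub (mem_set (measurable_linear_noise s)).
pose r := a / (sigma ^+ 2 * v).
have sv0 : 0 < sigma ^+ 2 * v by rewrite mulr_gt0 ?exprn_gt0.
have r0 : 0 < r by rewrite divr_gt0.
apply: le_trans (chernoff X a r0) _.
have -> : ('M_P X r = (expR (sigma ^+ 2 * r ^+ 2 / 2 * \sum_i s i ^+ 2))%:E)%E.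
  rewrite /mmt_gen_fun unlock -linear_noise_mgf.
  by apply: eq_integral => w _; rewrite /= mulrC.
rewrite -EFinM lee_fin -expRD ler_expR.
apply: (@le_trans _ _ (sigma ^+ 2 * r ^+ 2 / 2 * v - r * a)).
  by rewrite lerD2r ler_wpM2l// divr_ge0// mulr_ge0// sqr_ge0.
rewrite le_eqVlt; apply/orP; left; apply/eqP; rewrite /r; field.
by rewrite !gt_eqF.
Qed.

Lemma linear_noise_tail (s : 'I_n -> R) (v a : R) : 0 < v -> 0 < a ->
  \sum_i s i ^+ 2 <= v ->
  (P [set w | a <= `|\sum_i s i * eps i w|]%R <=
    (2 * expR (- (a ^+ 2 / (2 * sigma ^+ 2 * v))))%:E)%E.
Proof.
move=> v0 a0 sv.
have mT (t : 'I_n -> R) : measurable [set w | a <= \sum_i t i * eps i w].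
  rewrite [X in measurable X](_ : _ = [set: Omega] `&`
    (fun w => \sum_i t i * eps i w) @^-1` `[a, +oo[); last first.
    by apply/seteqP; split => w /=; rewrite in_itv/= andbT; [|case].
  by apply: measurable_linear_noise => //; exact: measurable_itv.
have -> : [set w | a <= `|\sum_i s i * eps i w|] =
    [set w | a <= \sum_i s i * eps i w] `|` [set w | a <= \sum_i (- s i) * eps i w].
  apply/seteqP; split => w /=; under [in X in _ \/ X]eq_bigr do rewrite mulNr;
    rewrite sumrN ler_normr.
    by move=> /orP.
  by move/orP.
apply: (le_trans (measureU2 _ _ _)) => //.
rewrite mulr_natl mulr2n EFinD leeD//; apply: linear_noise_upper_tail => //.
by under eq_bigr do rewrite sqrrN.
Qed.

End gaussian_tail.

(** * The oracle inequality for a fixed noise vector *)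

Section oracle.
Variables (R : realType) (m n : nat) (D : 'M[R]_(m, n)).
Hypothesis n_gt0 : (0 < n)%N.

Lemma norm2_sq_ge0 k (x : 'cV[R]_k) : 0 <= norm2_sq x.
Proof. by apply: sumr_ge0 => i _; rewrite sqr_ge0. Qed.

Lemma norm1_ge0 k (x : 'cV[R]_k) : 0 <= norm1 x.
Proof. by apply: sumr_ge0 => i _; rewrite normr_ge0. Qed.

(** The sum of the squared deviations from the mean is nonnegative. *)
Lemma mean_sqr_le (x : 'cV[R]_n) : n%:R^-1 * (\sum_i x i 0) ^+ 2 <= norm2_sq x.
Proof.
have n0 : 0 < n%:R :> R by rewrite ltr0n.
pose a := n%:R^-1 * \sum_i x i 0.
have : 0 <= \sum_i (x i 0 - a) ^+ 2 by apply: sumr_ge0 => i _; rewrite sqr_ge0.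
under eq_bigr do rewrite sqrrB.
rewrite big_split sumrB /= sumr_const card_ord -/(norm2_sq x).
rewrite sumrMnl -mulr_suml -mulr_natl -[X in _ + X]mulr_natl /a.
set s := \sum_i x i 0; have -> : n%:R * (n%:R^-1 * s) ^+ 2 = n%:R^-1 * s ^+ 2.
  by field; rewrite gt_eqF.
lra.
Qed.

(** Comparing th with the point at proportion t between th and tb, strong
    convexity of the quadratic part gives the inequality with an extra factor
    1 - t; then t tends to 0. *)
Lemma tv_argmin_strong (lambda : R) (y th tb : 'cV[R]_n) : 0 <= lambda ->
  is_argmin (tv_objective D lambda y) th ->
  tv_objective D lambda y th + n%:R^-1 * norm2_sq (th - tb) <=
  tv_objective D lambda y tb.
Proof.
move=> l0 thmin; have n0 : 0 < n%:R :> R by rewrite ltr0n.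
set b := n%:R^-1 * norm2_sq (th - tb).
have b0 : 0 <= b by rewrite mulr_ge0 ?norm2_sq_ge0// invr_ge0 ltW.
have key t : 0 < t <= 1 ->
    tv_objective D lambda y th + (1 - t) * b <= tv_objective D lambda y tb.
  move=> /andP[t0 t1]; have := thmin ((1 - t) *: th + t *: tb).
  have E2 : norm2_sq ((1 - t) *: th + t *: tb - y) =
      (1 - t) * norm2_sq (th - y) + t * norm2_sq (tb - y)
      - t * (1 - t) * norm2_sq (th - tb).
    rewrite /norm2_sq !mulr_sumr -big_split -sumrB; apply: eq_bigr => i _.
    by rewrite !mxE /=; ring.
  have E1 : norm1 (D *m ((1 - t) *: th + t *: tb)) <=
      (1 - t) * norm1 (D *m th) + t * norm1 (D *m tb).
    rewrite mulmxDr -!scalemxAr /norm1 !mulr_sumr -big_split /=.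
    apply: ler_sum => i _; rewrite !mxE; apply: le_trans (ler_normD _ _) _.
    by rewrite !normrM (ger0_norm (ltW t0)) ger0_norm// subr_ge0.
  rewrite -[X in _ -> is_true X](ler_pM2l t0) /tv_objective E2 /b.
  have := ler_wpM2l l0 E1.
  set A := norm2_sq (th - y); set B := norm2_sq (tb - y); set d := norm2_sq _.
  set u := norm1 (D *m th); set v := norm1 (D *m tb); set w := norm1 _.
  set q := n%:R^-1 => h h'.
  lra.
apply/ler_addgt0Pr => e e0.
(* The proportion e / (e + b) makes the loss t * b at most e. *)
have t01 : 0 < e / (e + b) <= 1.
  by rewrite divr_gt0 ?ltr_wpDr//= ler_pdivrMr ?mul1r ?lerDl// ltr_wpDr.
have := key _ t01; rewrite mulrBl mul1r => h.
have : e / (e + b) * b <= e.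
  rewrite mulrAC ler_pdivrMr ?ltr_wpDr// ler_pM2l// lerDr; exact: ltW.
lra.
Qed.

Variables (S : 'M[R]_(n, m)) (K : R).
Hypothesis SD : forall (theta : 'cV[R]_n) i,
  theta i 0 - n%:R^-1 * \sum_i' theta i' 0 = \sum_j S i j * (D *m theta) j 0.
Hypothesis K_gt0 : 0 < K.
Hypothesis D_le : forall theta : 'cV[R]_n, norm2_sq (D *m theta) <= K * norm2_sq theta.

(** Here L is n times lambda, and the hypothesis on S^T eps makes the
    regularisation dominate the noise on the range of D. *)
Lemma tv_oracle (L lambda : R) (thetastar eps th tb : 'cV[R]_n) (T : {set 'I_m}) :
  0 <= L -> lambda = L / n%:R ->
  (forall j, 2 * `|\sum_i S i j * eps i 0| <= L) ->
  is_argmin (tv_objective D lambda (thetastar + eps)) th ->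
  norm2_sq (th - thetastar) <= norm2_sq (tb - thetastar)
    + 2 * L * norm1 (coord_restrict (~: T)%SET (D *m tb))
    + 2 * K * L ^+ 2 * #|T|%:R + 2 * (n%:R^-1 * (\sum_i eps i 0) ^+ 2).
Proof.
move=> L0 lE zL thmin; have n0 : 0 < n%:R :> R by rewrite ltr0n.
have l0 : 0 <= lambda by rewrite lE divr_ge0// ltW.
have := tv_argmin_strong tb l0 thmin.
rewrite /tv_objective lE -(ler_pM2l n0) !mulrDr !mulVKf ?gt_eqF//.
rewrite -![L / _]mulrC -![_ * L * _]mulrA !mulVKf ?gt_eqF// => h.
set dl := th - tb in h *.
have E u : norm2_sq (u - (thetastar + eps)) =
    norm2_sq (u - thetastar) - 2 * (\sum_i eps i 0 * (u - thetastar) i 0) + norm2_sq eps.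
  rewrite /norm2_sq mulr_sumr -sumrB -big_split; apply: eq_bigr => i _.
  by rewrite !mxE /=; ring.
have Ed : \sum_i eps i 0 * dl i 0 = \sum_i eps i 0 * (th - thetastar) i 0
    - \sum_i eps i 0 * (tb - thetastar) i 0.
  by rewrite -sumrB; apply: eq_bigr => i _; rewrite !mxE; ring.
have noise : \sum_i eps i 0 * dl i 0 =
    n%:R^-1 * ((\sum_i eps i 0) * (\sum_i dl i 0)) +
    \sum_j (\sum_i S i j * eps i 0) * (D *m dl) j 0.
  transitivity (\sum_i (eps i 0 * (n%:R^-1 * \sum_i' dl i' 0)
     + \sum_j S i j * eps i 0 * (D *m dl) j 0)).
    apply: eq_bigr => i _; rewrite -[dl i 0 in LHS](subrK (n%:R^-1 * \sum_i' dl i' 0)).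
    rewrite SD mulrDr addrC; congr (_ + _); rewrite mulr_sumr.
    by apply: eq_bigr => j _; ring.
  rewrite big_split /= -mulr_suml; congr (_ + _); first by ring.
  by rewrite exchange_big; apply: eq_bigr => j _; rewrite mulr_suml.
(* The Young inequality that leaves half of the quadratic term for the edges. *)
have avg : 2 * (n%:R^-1 * ((\sum_i eps i 0) * (\sum_i dl i 0))) <=
    2 * (n%:R^-1 * (\sum_i eps i 0) ^+ 2) + norm2_sq dl / 2.
  have := mean_sqr_le dl; set a := \sum_i eps i 0; set b := \sum_i dl i 0 => hb.
  have : 0 <= n%:R^-1 * (2 * a - b) ^+ 2 by rewrite mulr_ge0 ?sqr_ge0 ?invr_ge0 ?ltW.
  move: hb; set q := n%:R^-1; nra.
(* Entrywise, with x the entry of D dl: the square (2 K L - |x|)^2 is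
   nonnegative, used inside T, and the triangle inequality, used outside. *)
have edges : 2 * (\sum_j (\sum_i S i j * eps i 0) * (D *m dl) j 0) +
    L * norm1 (D *m tb) - L * norm1 (D *m th) <=
    2 * L * norm1 (coord_restrict (~: T)%SET (D *m tb)) + 2 * K * L ^+ 2 * #|T|%:R
    + norm2_sq dl / 2.
  apply: (@le_trans _ _ (\sum_j (2 * L * `|coord_restrict (~: T)%SET (D *m tb) j 0|
     + (if j \in T then 2 * K * L ^+ 2 else 0) + (2 * K)^-1 * (D *m dl) j 0 ^+ 2))).
    rewrite /norm1 !mulr_sumr -big_split -sumrB; apply: ler_sum => j _ /=.
    have -> : (D *m th) j 0 = (D *m dl) j 0 + (D *m tb) j 0.
      by rewrite /dl mulmxBr !mxE subrK.
    have := zL j; set z := \sum_i _; set x := (D *m dl) j 0.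
    rewrite [coord_restrict _ _ _ _]mxE inE.
    set t := (D *m tb) j 0 => hz.
    have zx : 2 * (z * x) <= L * `|x|.
      apply: le_trans (ler_norm _) _; rewrite !normrM ger0_norm// mulrA.
      by rewrite ler_wpM2r.
    have q0 : 0 <= (2 * K)^-1 * x ^+ 2.
      by rewrite mulr_ge0 ?sqr_ge0// invr_ge0 mulr_ge0// ltW.
    case: ifP => [/negbTE -> | /negbFE ->].
      have : `|x| <= `|x + t| + `|t|.
        by rewrite -{1}[x](addrK t); exact: ler_normB.
      move=> /(ler_wpM2l L0); rewrite mulrDr; lra.
    have : `|t| <= `|x + t| + `|x|.
      by rewrite -{1}[t](addKr x) addrC; exact: ler_normB.
    move=> /(ler_wpM2l L0); rewrite mulrDr normr0 mulr0 add0r => h1.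
    have : 0 <= (2 * K)^-1 * (2 * K * L - `|x|) ^+ 2.
      by rewrite mulr_ge0 ?sqr_ge0// invr_ge0 mulr_ge0// ltW.
    have -> : (2 * K)^-1 * (2 * K * L - `|x|) ^+ 2 =
       2 * K * L ^+ 2 - 2 * (L * `|x|) + (2 * K)^-1 * `|x| ^+ 2.
      by field; rewrite gt_eqF.
    rewrite real_normK ?num_real//; lra.
  rewrite !big_split /= -!mulr_sumr -/(norm1 _) -/(norm2_sq _).
  rewrite -big_mkcond /= sumr_const -[X in _ + X + _]mulr_natr lerD2l.
  rewrite mulrC ler_pdivrMr ?mulr_gt0//.
  by apply: le_trans (D_le dl) _; rewrite [leRHS]mulrA divfK// mulrC.
move: h; rewrite !E => h; lra.
Qed.

End oracle.

(** * The noise event *)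

Section logarithms.
Variables (R : realType) (n : nat) (delta : R).
Hypotheses (n_gt0 : (0 < n)%N) (delta01 : 0 < delta < 1).

Let delta_gt0 : 0 < delta. Proof. by case/andP: delta01. Qed.

Lemma expR_log_e : expR (- log_e delta) = delta / expR 1.
Proof. by rewrite expRN lnK ?invf_div// posrE divr_gt0// expR_gt0. Qed.

Lemma expR_log_en : expR (- log_en n delta) = delta / (expR 1 * n%:R).
Proof.
by rewrite expRN lnK ?invf_div// posrE divr_gt0// mulr_gt0 ?expR_gt0// ltr0n.
Qed.

Lemma log_e_ge1 : 1 <= log_e delta.
Proof.
rewrite -[leLHS]expRK ler_ln ?posrE ?divr_gt0 ?expR_gt0//.
by rewrite ler_pdivlMr// ler_piMr ?expR_ge0//; case/andP: delta01 => _ /ltW.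
Qed.

Lemma log_e_le_log_en : log_e delta <= log_en n delta.
Proof.
have n0 : 0 < n%:R :> R by rewrite ltr0n.
rewrite ler_ln ?posrE ?divr_gt0 ?mulr_gt0 ?expR_gt0//.
by rewrite ler_pM2r ?invr_gt0// ler_peMr ?expR_ge0// ler1n.
Qed.

Lemma log_en_ge1 : 1 <= log_en n delta.
Proof. exact: le_trans log_e_ge1 log_e_le_log_en. Qed.

Lemma two_le_expR1 : 2 <= expR 1 :> R.
Proof. by have := expR_ge1Dx (1 : R). Qed.

(** The exponent 2 d log(e n / delta) gains a factor exp(-2 d) beyond
    delta / n, which absorbs the factor 2 d of the number of edges because
    1 + x <= exp x. *)
Lemma edge_union_bound (d m : nat) : (0 < d)%N -> (m <= d * n)%N ->
  m%:R * (2 * expR (- (2 * d%:R * log_en n delta))) <= delta.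
Proof.
move=> d0 mdn; have n0 : 0 < n%:R :> R by rewrite ltr0n.
have d1 : 1 <= d%:R :> R by rewrite ler1n.
apply: (@le_trans _ _ (d%:R * n%:R * (2 * (delta / (expR 1 * n%:R) * expR (- (2 * d%:R - 1)))))).
  rewrite ler_pM//.
  - by rewrite -natrM ler_nat.
  rewrite ler_pM2l// -expR_log_en -expRD ler_expR.
  have := log_en_ge1; nra.
have -> : d%:R * n%:R * (2 * (delta / (expR 1 * n%:R) * expR (- (2 * d%:R - 1)))) =
   delta * (2 * d%:R * expR (- (2 * d%:R))).
  have -> : - (2 * d%:R - 1) = - (2 * d%:R) + 1 :> R by ring.
  by rewrite expRD; field; rewrite !gt_eqF ?expR_gt0.
apply: ler_piMr; first exact: ltW.
rewrite expRN ler_pdivrMr ?expR_gt0// mul1r.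
apply: le_trans (expR_ge1Dx _); lra.
Qed.

End logarithms.

Lemma union_bound (R : realType) (disp : measure_display) (Omega : measurableType disp)
    (P : probability Omega R) (m : nat) (B : 'I_m -> set Omega) (b : R) :
  (forall j, measurable (B j)) -> (forall j, (P (B j) <= b%:E)%E) ->
  (P (\big[setU/set0]_j B j) <= (m%:R * b)%:E)%E.
Proof.
move=> mB PB.
have -> : m%:R * b = \sum_(j < m) b by rewrite sumr_const card_ord mulr_natl.
rewrite -sumEFin.
have : measurable (\big[setU/set0]_j B j) /\
    (P (\big[setU/set0]_j B j) <= \sum_(j < m) b%:E)%E; last by case.
apply: (big_rec2 (fun U x => measurable U /\ (P U <= x)%E)) => [|j U x _ [mU PU]].
  by split; rewrite ?measure0.
split; first exact: measurableU.
apply: (le_trans (measureU2 _ (mB j) mU)); apply: leeD; [exact: PB|exact: PU].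
Qed.

Section noise_event.
Context (R : realType) (disp : measure_display) (Omega : measurableType disp).
Variables (P : probability Omega R) (d n m : nat) (eps : 'I_n -> {RV P >-> R}).
Variables (sigma delta v : R) (S : 'M[R]_(n, m)).
Hypotheses (d_gt0 : (0 < d)%N) (n_gt0 : (0 < n)%N) (m_le : (m <= d * n)%N).
Hypotheses (sigma_gt0 : 0 < sigma) (delta01 : 0 < delta < 1) (v_gt0 : 0 < v).
Hypothesis heps : gaussian_noise eps sigma.
Hypothesis S_le : forall j, \sum_i S i j ^+ 2 <= v.

(** The entries of S^T eps have variance at most sigma^2 v, so their tail at
    L / 2 is 2 exp(- 2 d log(e n / delta)) with this L.  The sum of the noise
    has variance n sigma^2, and its tail at the chosen level is
    2 delta / e <= delta. *)
Lemma noise_event :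
  let L := 4 * Num.sqrt (d%:R * v) * sigma * Num.sqrt (log_en n delta) in
  holds_with_prob P (1 - 2 * delta) (fun w =>
    (forall j, 2 * `|\sum_i S i j * eps i w| <= L) /\
    n%:R^-1 * (\sum_i eps i w) ^+ 2 <= 2 * sigma ^+ 2 * log_e delta).
Proof.
move=> L; have n0 : 0 < n%:R :> R by rewrite ltr0n.
have d0 : 0 < d%:R :> R by rewrite ltr0n.
have len1 := log_en_ge1 n_gt0 delta01; have le1 := log_e_ge1 delta01.
have [del0 _] := andP delta01.
have L0 : 0 < L.
  by rewrite !mulr_gt0 ?sqrtr_gt0 ?mulr_gt0//; apply: lt_le_trans len1.
have L2 : L ^+ 2 = 16 * (d%:R * v) * sigma ^+ 2 * log_en n delta.
  rewrite /L !exprMn sqr_sqrtr; last by rewrite mulr_ge0// ltW.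
  by rewrite sqr_sqrtr; [ring|exact: le_trans len1].
pose a := Num.sqrt (2 * sigma ^+ 2 * n%:R * log_e delta).
have rad0 : 0 < 2 * sigma ^+ 2 * n%:R * log_e delta.
  by rewrite !mulr_gt0 ?exprn_gt0//; apply: lt_le_trans le1.
have a0 : 0 < a by rewrite sqrtr_gt0.
pose B j := [set w | L / 2 <= `|\sum_i S i j * eps i w|].
pose B0 := [set w | a <= `|\sum_i 1 * eps i w|].
have mtail (s : 'I_n -> R) b : measurable [set w | b <= `|\sum_i s i * eps i w|].
  rewrite [X in measurable X](_ : _ = [set: Omega] `&`
    (fun w => `|\sum_i s i * eps i w|) @^-1` `[b, +oo[); last first.
    by apply/seteqP; split => w /=; rewrite in_itv/= andbT; [|case].
  apply: measurableT_comp => //; first exact: measurable_linear_noise.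
have PB j : (P (B j) <= (2 * expR (- (2 * d%:R * log_en n delta)))%:E)%E.
  apply: le_trans (linear_noise_tail sigma_gt0 heps v_gt0 _ (S_le j)) _.
    by rewrite divr_gt0.
  rewrite lee_fin ler_pM2l// ler_expR lerN2.
  rewrite expr_div_n L2 le_eqVlt; apply/orP; left; apply/eqP; field.
  by rewrite !gt_eqF.
have PB0 : (P B0 <= delta%:E)%E.
  have s1 : \sum_(i < n) (1 : R) ^+ 2 <= n%:R.
    by under eq_bigr do rewrite expr1n; rewrite sumr_const card_ord.
  apply: le_trans (linear_noise_tail sigma_gt0 heps n0 a0 s1) _.
  rewrite lee_fin sqr_sqrtr; last exact: ltW.
  have -> : 2 * sigma ^+ 2 * n%:R * log_e delta / (2 * sigma ^+ 2 * n%:R) = log_e delta.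
    by field; rewrite !gt_eqF.
  rewrite expR_log_e// mulrA [2 * _]mulrC -mulrA; apply: ler_piMr; first exact: ltW.
  by rewrite ler_pdivrMr ?expR_gt0// mul1r two_le_expR1.
pose U := \big[setU/set0]_j B j `|` B0.
have mUB : measurable (\big[setU/set0]_j B j) by apply: bigsetU_measurable => j _; exact: mtail.
have mU : measurable U by apply: measurableU => //; exact: mtail.
exists (~` U); split; first exact: measurableC.
  rewrite probability_setC// EFinB leeB//.
  apply: (le_trans (measureU2 _ _ _)) => //; first exact: mtail.
  rewrite mulr_natl mulr2n EFinD leeD//.
  apply: le_trans (union_bound _ PB) _; first by move=> j; exact: mtail.
  by rewrite lee_fin edge_union_bound.
move=> w; rewrite /U setCU => -[nB nB0]; split.
  move=> j; rewrite leNgt; apply/negP => h; apply: nB.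
  by rewrite (bigD1 j)//=; left; rewrite /B /= ler_pdivrMr// mulrC ltW.
have : \sum_i eps i w = \sum_i 1 * eps i w by apply: eq_bigr => i _; rewrite mul1r.
move=> ->; move/negP: nB0; rewrite -ltNge => h.
rewrite ler_pdivrMl//.
apply: (@le_trans _ _ (a ^+ 2)).
  by rewrite -real_normK ?num_real// lerXn2r ?nnegrE// ltW.
rewrite sqr_sqrtr; [lra|exact: ltW].
Qed.

End noise_event.

(** * Consequences of the oracle inequality *)

(** With T empty the square root of log(e n / delta) in lambda is bounded by
    the logarithm itself, which is at least 1; with T the support of
    D thetastar the l1 term vanishes.  In the last bound the remainder
    sigma^2 log(e / delta) is absorbed: by the hypothesis when the l1 term is
    the minimum, and otherwise because that hypothesis forces D thetastar to be
    nonzero. *)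
Lemma oracle_consequences (R : realType) (m n : nat) (D : 'M[R]_(m, n))
    (C c sigma delta : R) (thetastar thetahat : 'cV[R]_n) :
  (0 < n)%N -> 0 < delta < 1 -> 0 < sigma -> 0 < C -> 0 < c ->
  let lambda := c * sigma * Num.sqrt (log_en n delta) / n%:R in
  let C' := 4 * c + 2 * C in
  (forall thetabar T, mse thetahat thetastar <=
     oracle_bound D C sigma delta lambda thetastar thetabar T) ->
  [/\ mse thetahat thetastar <=
        inf [set oracle_bound D C sigma delta lambda thetastar p.1 p.2
            | p in [set: 'cV[R]_n * {set 'I_m}]],
      mse thetahat thetastar <=
        C' * ((sparsity_min D sigma thetastar * log_en n delta
               + sigma ^+ 2 * log_e delta) / n%:R)
    & sigma * log_e delta <= norm1 (D *m thetastar) * log_en n delta ->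
      mse thetahat thetastar <=
        C' * (sparsity_min D sigma thetastar / n%:R * log_en n delta)].
Proof.
move=> n_gt0 delta01 s0 C0 c0 lambda C' oracle.
have n0 : 0 < n%:R :> R by rewrite ltr0n.
have len1 := log_en_ge1 n_gt0 delta01; have le1 := log_e_ge1 delta01.
have lle := log_e_le_log_en n_gt0 delta01.
set l := log_en n delta in len1 lle *; set k := log_e delta in le1 lle *.
have l0 : 0 < l by lra.
set N1 := norm1 (D *m thetastar); have N10 : 0 <= N1 by exact: norm1_ge0.
have self0 : norm2_sq (thetastar - thetastar) = 0.
  by rewrite subrr /norm2_sq big1// => i _; rewrite mxE expr0n.
have B1 : mse thetahat thetastar * n%:R <= 4 * c * (sigma * N1) * l + C * sigma ^+ 2 * k.
  have := oracle thetastar finset.set0.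
  rewrite /oracle_bound self0 cards0 mulr0 mul0r !add0r -/k.
  have -> : coord_restrict (~: finset.set0)%SET (D *m thetastar) = D *m thetastar.
    by apply/matrixP => i j; rewrite mxE !inE /= ord1.
  rewrite -/N1 -(ler_pM2r n0) => h; apply: le_trans h _.
  rewrite mulrDl lerD//; last by rewrite mulrAC divfK ?gt_eqF.
  have -> : 4 * lambda * N1 * n%:R = 4 * c * (sigma * N1) * Num.sqrt l.
    by rewrite /lambda -/l; field; rewrite gt_eqF.
  have sl : Num.sqrt l <= l.
    have s1 : 1 <= Num.sqrt l by rewrite -[leLHS]sqrtr1 ler_wsqrtr.
    by rewrite -[leRHS](sqr_sqrtr (ltW l0)) expr2 ler_peMl// sqrtr_ge0.
  by apply: ler_wpM2l => //; rewrite !mulr_ge0// ltW.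
have B0 : mse thetahat thetastar * n%:R <=
    C * (sigma ^+ 2 * (norm0 (D *m thetastar))%:R) * l + C * sigma ^+ 2 * k.
  pose T := [set i | (D *m thetastar) i 0 != 0]%SET.
  have := oracle thetastar T; rewrite /oracle_bound.
  have -> : norm1 (coord_restrict (~: T)%SET (D *m thetastar)) = 0.
    rewrite /norm1 big1// => i _; rewrite mxE !inE negbK.
    by case: eqP => [->|]; rewrite normr0.
  have -> : #|T| = norm0 (D *m thetastar) by rewrite cardsE.
  rewrite self0 !mulr0 !add0r -/l -/k -(ler_pM2r n0) => h.
  apply: le_trans h _; rewrite mulrAC divfK ?gt_eqF//; lra.
set M := sparsity_min D sigma thetastar.
have M0 : 0 <= M 
  by rewrite /M /sparsity_min le_min !mulr_ge0 ?sqr_ge0 ?(ltW s0).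
have BM : mse thetahat thetastar * n%:R <= (4 * c + C) * M * l + C * sigma ^+ 2 * k.
  have cl : 0 <= 4 * c * M * l by rewrite !mulr_ge0// ltW.
  have Cl : 0 <= C * M * l by rewrite !mulr_ge0// ltW.
  have := B0; have := B1; move: cl Cl; rewrite /M /sparsity_min -/N1.
  by case: (leP (sigma * N1)) => _ h1 h2 h3 h4; lra.
have sk0 : 0 <= sigma ^+ 2 * k by rewrite mulr_ge0 ?sqr_ge0//; lra.
split.
- apply: lb_le_inf; first by exists (oracle_bound D C sigma delta lambda thetastar 0 finset.set0); exists (0, finset.set0).
  by move=> _ [p _ <-]; exact: oracle.
- rewrite mulrA ler_pdivlMr//; apply: le_trans BM _; rewrite /C'.
  have : 0 <= C * M * l by rewrite !mulr_ge0// ltW.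
  have : 0 <= C * (sigma ^+ 2 * k) by rewrite mulr_ge0// ltW.
  have : 0 <= c * (sigma ^+ 2 * k) by rewrite mulr_ge0// ltW.
  lra.
move=> hyp.
have kM : sigma ^+ 2 * k <= M * l.
  have h1 : sigma ^+ 2 * k <= sigma * N1 * l.
    by rewrite expr2 -!mulrA ler_pM2l.
  have h2 : sigma ^+ 2 * k <= sigma ^+ 2 * (norm0 (D *m thetastar))%:R * l.
    rewrite -mulrA ler_pM2l ?exprn_gt0//.
    apply: (le_trans lle); apply: ler_peMl; first exact: ltW.
    rewrite ler1n lt0n.
    apply/negP => /eqP /card0_eq z0.
    have N1z : N1 = 0.
      rewrite /N1 /norm1 big1// => i _; have := z0 i; rewrite !inE => /negbFE/eqP ->.
      by rewrite normr0.
    move: hyp; rewrite -/k N1z mul0r leNgt mulr_gt0//; lra.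
  by rewrite /M /sparsity_min -/N1; case: (leP (sigma * N1)).
rewrite [_ / _ * _]mulrAC mulrA ler_pdivlMr//.
apply: le_trans BM _; rewrite /C'.
have : 0 <= c * M * l by rewrite !mulr_ge0// ltW.
have := ler_wpM2l (ltW C0) kM; lra.
Qed.

Theorem corollary7 (R : realType) (d : nat) (hd : (3 <= d)%N) :
  exists C c C' : R, [/\ 0 < C, 0 < c, 0 < C' &
    forall (delta : R) (hdelta : 0 < delta < 1)
           (N : nat) (hN : (0 < N)%N)
           (m : nat) (D : 'M[R]_(m, (N ^ d)%N)) (hD : grid_incidence D)
           (disp : measure_display) (Omega : measurableType disp)
           (P : probability Omega R)
           (sigma : R) (hsigma : 0 < sigma)
           (eps : 'I_(N ^ d)%N -> {RV P >-> R})
           (heps : gaussian_noise eps sigma)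
           (thetastar : 'cV[R]_(N ^ d)%N)
           (thetahat : Omega -> 'cV[R]_(N ^ d)%N),
      let n := (N ^ d)%N in
      let lambda := c * sigma * Num.sqrt (log_en n delta) / n%:R in
      let y := fun w : Omega => thetastar + \col_i eps i w in
      (forall w, is_argmin (tv_objective D lambda (y w)) (thetahat w)) ->
      holds_with_prob P (1 - 2 * delta) (fun w =>
        [/\ mse (thetahat w) thetastar <=
              inf [set oracle_bound D C sigma delta lambda thetastar p.1 p.2
                  | p in [set: 'cV[R]_(N ^ d)%N * {set 'I_m}]],
            mse (thetahat w) thetastar <=
              C' * ((sparsity_min D sigma thetastar * log_en n delta
                     + sigma ^+ 2 * log_e delta) / n%:R)
          & sigma * log_e delta <= norm1 (D *m thetastar) * log_en n delta ->
            mse (thetahat w) thetastar <=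
              C' * (sparsity_min D sigma thetastar / n%:R * log_en n delta)])].
Proof.
pose v : R := 4 * 8 ^+ d.
have v0 : 0 < v by rewrite mulr_gt0// exprn_gt0.
have d0 : (0 < d)%N by apply: leq_trans hd.
have dR0 : 0 < d%:R :> R by rewrite ltr0n.
pose c : R := 4 * Num.sqrt (d%:R * v).
have c0 : 0 < c by rewrite mulr_gt0// sqrtr_gt0 mulr_gt0.
(* With K = 4 d, the term 2 K L^2 |T| of tv_oracle is 8 d c^2 |T| times
   sigma^2 log(e n / delta); the noise average contributes the 4. *)
pose C : R := 8 * d%:R * c ^+ 2 + 4.
have C0 : 0 < C by rewrite addr_gt0 ?(mulr_gt0 (mulr_gt0 _ _) (exprn_gt0 _ _)).
exists C, c, (4 * c + 2 * C); split => //; first by rewrite addr_gt0 ?(mulr_gt0 _ c0) ?(mulr_gt0 _ C0).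
move=> delta hdelta N hN m D hD disp Omega P sigma hsigma eps heps ts th n lambda y thmin.
have n_gt0 : (0 < n)%N by rewrite expn_gt0 hN.
have n0 : 0 < n%:R :> R by rewrite ltr0n.
have [S [SD S_le]] := grid_right_inverse hd hN hD.
have m_le : (m <= d * n)%N := grid_edge_count hD.
have [A [mA PA good]] := noise_event d0 n_gt0 m_le hsigma hdelta v0 heps S_le.
exists A; split => // w /good[edges avg].
apply: oracle_consequences => // tb T.
pose L := c * sigma * Num.sqrt (log_en n delta).
have l1 := log_en_ge1 n_gt0 hdelta; have k1 := log_e_ge1 hdelta.
have L0 : 0 <= L by rewrite !mulr_ge0 ?sqrtr_ge0 ?ltW.
have K0 : 0 < 4 * d%:R :> R by rewrite mulr_gt0.
have := @tv_oracle R m n D n_gt0 S _ SD K0 (fun theta => grid_gradient_sqr theta hD)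
  L lambda ts (\col_i eps i w) (th w) tb T L0 erefl _ (thmin w).
have colE : \sum_i (\col_i eps i w : 'cV[R]_n) i 0 = \sum_i eps i w.
  by apply: eq_bigr => i _; rewrite mxE.
rewrite colE => h.
rewrite /mse /oracle_bound ler_pdivrMl//; apply: (le_trans (h _)).
  move=> j; rewrite (eq_bigr (fun i => S i j * eps i w)) ?edges// => i _.
  by rewrite mxE.
set N0 := norm2_sq _; set N1 := norm1 _; have N10 : 0 <= N1 by exact: norm1_ge0.
have -> : n%:R * (n%:R^-1 * N0 + 4 * lambda * N1 +
    C * sigma ^+ 2 / n%:R * (#|T|%:R * log_en n delta + log_e delta)) =
    N0 + 4 * L * N1 + C * sigma ^+ 2 * (#|T|%:R * log_en n delta + log_e delta).
  by rewrite /lambda /L; field; rewrite gt_eqF.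
have L2 : L ^+ 2 = c ^+ 2 * sigma ^+ 2 * log_en n delta.
  by rewrite /L exprMn [X in X * _]exprMn sqr_sqrtr; last exact: le_trans ler01 l1.
have LN : 0 <= L * N1 by rewrite mulr_ge0.
have Tl : 0 <= sigma ^+ 2 * (#|T|%:R * log_en n delta).
  by rewrite mulr_ge0 ?sqr_ge0// mulr_ge0//; exact: le_trans ler01 l1.
have kl : 0 <= 8 * d%:R * c ^+ 2 * (sigma ^+ 2 * log_e delta).
  by rewrite !mulr_ge0 ?sqr_ge0//; lra.
rewrite L2 /C; lra.
Qed.
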